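(* Let $a<b$ be real numbers, let $m,l,n\in\mathbb{N}$ (positive integers), let $A\in(C^{(n-1)})^{m\times m}$, and let $B\colon(C^{(n)})^{m}\to\mathbb{C}^{l}$ be an arbitrary continuous linear operator. Put $(Ly)(t):=y'(t)+A(t)y(t)$ for $y\in(C^{(n)})^m$. Then the continuous linear operator $$(L,B)\colon (C^{(n)})^m\to (C^{(n-1)})^m\times\mathbb{C}^{l},\qquad y\mapsto(Ly,By),$$ is Fredholm with index $m-l$.
   Context: For an integer $n\ge 0$, $C^{(n)}$ denotes the complex Banach space of all $n$ times continuously differentiable functions $x\colon[a,b]\to\mathbb{C}$ with norm $\|x\|_{(n)}=\sum_{j=0}^{n}\max_{a\le t\le b}|x^{(j)}(t)|$; $C^{(0)}=C$ is the space of continuous functions. $(C^{(n)})^m$ and $(C^{(n)})^{m\times m}$ are the complex Banach spaces of $m$-dimensional (column) vector functions and of $m\times m$ matrix functions, respectively, with all components in $C^{(n)}$; the norm of a vector function is the sum of the norms of its components, and the norm of a matrix function is the maximum of the norms of its columns. A continuous linear operator $T\colon X\to Y$ between Banach spaces is called Fredholm if $\ker T$ and $\operatorname{coker}T:=Y/T(X)$ are finite-dimensional; its index is $\operatorname{ind}T:=\dim\ker T-\dim\operatorname{coker}T$. *)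

(* Defs.v *)
From HB Require Import structures.
From mathcomp Require Import all_boot all_order all_algebra.
From mathcomp Require Import all_classical all_reals.
From mathcomp Require Import topology normedtype.
From mathcomp Require Import complex ring.

Set Implicit Arguments.
Unset Strict Implicit.
Unset Printing Implicit Defensive.

Import Order.TTheory GRing.Theory Num.Theory.
Import numFieldNormedType.Exports.
Import ComplexField.

Local Open Scope classical_set_scope.
Local Open Scope ring_scope.

(* The canonical module structure of [R[i]] is the one over [R]; packing [R[i]]
   as a [numClosedFieldType] selects its structure of normed module over
   itself. *)
Definition Cx (R : realType) : numClosedFieldType := R[i].

Section Calculus.
Variables (R : realType) (a b : R).

Definition segment : Type := [set` `[a, b]].
HB.instance Definition _ := PseudoMetric.on segment.

Implicit Types (f g : segment -> Cx R) (t : segment).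

(* [t^'] is the punctured neighbourhood filter of [t] in the subspace [a, b],
   so that the derivatives at the end points are one-sided. *)
Definition diff_quot f t (s : segment) : Cx R :=
  ((set_val s - set_val t)%:C%C)^-1 * (f s - f t).

Definition derivable_seg f := forall t, cvg (diff_quot f t @ t^').

Definition deriv_seg f : segment -> Cx R := fun t => lim (diff_quot f t @ t^').

Fixpoint smooth (n : nat) f : Prop :=
  if n is k.+1 then derivable_seg f /\ smooth k (deriv_seg f) else continuous f.

(* For continuous [f] on the compact [a, b] the supremum is a maximum. *)
Definition sup_norm f : R := sup (range (fun t => Normc.normc (f t))).

End Calculus.

Section CalculusTheory.
Variables (R : realType) (a b : R).
Local Notation I := (segment a b).
Local Notation C := (Cx R).
Implicit Types (f g : I -> C) (t s : I).

Lemma normC_normc (z : C) : `|z| = (Normc.normc z)%:C%C.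
Proof. by []. Qed.

Lemma normc_ge0 (z : C) : 0 <= Normc.normc z.
Proof. by case: z => x y; exact: sqrtr_ge0. Qed.

Lemma cvg_real_complex (T : Type) (F : set_system T) (FF : Filter F)
    (h : T -> R) (l : R) :
  h x @[x --> F] --> l -> ((h x)%:C%C : C) @[x --> F] --> (l%:C%C : C).
Proof.
move=> /cvgrPdist_lt hl; apply/cvgrPdist_lt => e e0.
have [r r0 ->] : exists2 r : R, 0 < r & e = r%:C%C.
  have := e0; rewrite ltcE /= => /andP[/eqP im re].
  by exists (complex.Re e) => //; case: (e) im re => x y /= -> _.
apply: filterS (hl r r0) => x.
by rewrite -raddfB normC_normc ltcR /= expr0n addr0 sqrtr_sqr.
Qed.

Lemma set_val_continuous : continuous (set_val : I -> R).
Proof. exact: initial_continuous. Qed.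


Lemma cvg_set_val_dnbhs t : set_val s @[s --> t^'] --> (set_val t : R).
Proof. exact: (cvg_trans (cvg_app _ (@nbhs_dnbhs _ t)) (@set_val_continuous t)). Qed.

Lemma sub_set_val_eq0 t s :
  ((set_val s - set_val t : R)%:C%C == 0 :> C) = (s == t).
Proof.
by rewrite (_ : (0 : C) = (0 : R)%:C%C)// (inj_eq (@complexI R)) subr_eq0.
Qed.

Lemma derivable_continuous f : derivable_seg f -> continuous f.
Proof.
move=> df t; have /cvg_ex[l dl] := df t.
have tF : ((set_val s - set_val t)%:C%C : C) @[s --> t^'] --> (0 : C).
  have -> : (0 : C) = (set_val t - set_val t)%:C%C by rewrite subrr.
  apply: cvg_real_complex; apply: cvgB; last exact: cvg_cst.
  exact: cvg_set_val_dnbhs.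
have h : ((set_val s - set_val t)%:C%C * diff_quot f t s) @[s --> t^'] --> (0 : C).
  by rewrite -(mul0r l); exact: (cvgM tF dl).
have {}h := iffLR (@cvgrPdist_lt C C _ _ (dnbhs_filter t) _ _) h.
apply/(@cvgrPdist_lt _ _ _ _ (nbhs_filter t)) => e e0.
have := h e e0; rewrite /dnbhs near_withinE; apply: filterS => s /=.
have [->|st] := eqVneq s t; first by move=> _; rewrite subrr normr0.
move=> /(_ isT).
rewrite /diff_quot sub0r normrN mulrA mulfV ?sub_set_val_eq0//.
by rewrite mul1r distrC.
Qed.

Lemma smoothW n f : smooth n.+1 f -> smooth n f.
Proof.
elim: n f => [|n IH] f [df sf]; first exact: derivable_continuous.
by split=> //; exact: IH.
Qed.

Lemma smooth_continuous n f j : smooth n f -> (j <= n)%N ->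
  continuous (iter j (@deriv_seg R a b) f).
Proof.
elim: n f j => [|n IH] f j.
  by move=> cf; rewrite leqn0 => /eqP ->; exact: cf.
case: j => [|j] sf jn; first exact: (derivable_continuous sf.1).
by rewrite iterSr; exact: IH sf.2 jn.
Qed.

Hypothesis ab : a < b.

Lemma dnbhs_itv_proper t : ProperFilter t^'.
Proof.
split; last exact: dnbhs_filter.
rewrite /dnbhs /= => /nbhs_ballP[e /= e0 /= tS].
have /andP[ta tb] : a <= set_val t <= b.
  by have := set_valP t; rewrite /= in_itv.
suff [x [xab xt xe]] : exists x : R,
    [/\ x \in `[a, b], x != set_val t & `|set_val t - x| < e].
  have xA : x \in [set` `[a, b]] by rewrite inE.
  apply: (tS (exist _ x xA)) => /=; first exact: xe.
  by apply/eqP => xt'; move: xt; rewrite -xt' /= eqxx.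
have [tb'|bt] := ltP (set_val t) b.
  pose d := Num.min (b - set_val t) (e / 2).
  have d0 : 0 < d by rewrite lt_min subr_gt0 tb' divr_gt0.
  exists (set_val t + d); split.
  - rewrite in_itv /= (le_trans ta) ?lerDl ?(ltW d0)//=.
    by rewrite -lerBrDl ge_min lexx.
  - by rewrite gt_eqF// ltrDl.
  - rewrite opprD addNKr normrN gtr0_norm//.
    by rewrite gt_min (_ : e / 2 < e) ?orbT// gtr_pMr// invf_lt1// ltr1n.
have {tb}tb : set_val t = b by apply/le_anti; rewrite tb.
pose d := Num.min (b - a) (e / 2).
have d0 : 0 < d by rewrite lt_min subr_gt0 ab divr_gt0.
exists (b - d); rewrite tb; split.
- rewrite in_itv /= gerBl (ltW d0) andbT lerBrDl -lerBrDr.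
  by rewrite ge_min lexx.
- by rewrite lt_eqF// gtrBl.
- rewrite opprB addrC subrK gtr0_norm//.
  by rewrite gt_min (_ : e / 2 < e) ?orbT// gtr_pMr// invf_lt1// ltr1n.
Qed.

Lemma derivP f g :
  (forall t, diff_quot f t @ t^' --> (g t : C)) -> derivable_seg f /\ deriv_seg f = g.
Proof.
move=> fg; split=> [t|]; first by apply/cvg_ex; exists (g t); exact: fg.
apply/funext => t; have pt := dnbhs_itv_proper t.
exact: (cvg_lim (@norm_hausdorff _ _) (fg t)).
Qed.

Lemma derivable_cvg f t : derivable_seg f -> diff_quot f t @ t^' --> (deriv_seg f t : C).
Proof. by move=> /(_ t). Qed.

Lemma deriv_lin (c : C) f g : derivable_seg f -> derivable_seg g ->
  derivable_seg (c *: f + g) /\ deriv_seg (c *: f + g) = c *: deriv_seg f + deriv_seg g.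
Proof.
move=> df dg; apply: derivP => t.
rewrite (_ : diff_quot _ t = c *: diff_quot f t + diff_quot g t).
  apply: cvgD; last exact: derivable_cvg.
  by apply: cvgZr; exact: derivable_cvg.
apply/funext => s.
have e (k x y x' y' : C) : k * ((c * x + y) - (c * x' + y')) =
    c * (k * (x - x')) + k * (y - y') by ring.
exact: e.
Qed.

Lemma deriv_mul f g : derivable_seg f -> derivable_seg g ->
  derivable_seg (f \* g) /\ deriv_seg (f \* g) = deriv_seg f \* g + f \* deriv_seg g.
Proof.
move=> df dg; apply: derivP => t.
have cg : g s @[s --> t^'] --> (g t : C).
  have ct : g s @[s --> t] --> (g t : C) by exact: derivable_continuous.
  exact: (cvg_trans (cvg_app g (@nbhs_dnbhs _ t)) ct).
rewrite (_ : diff_quot _ t =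
    (fun s => diff_quot f t s * g s) + (fun s => f t * diff_quot g t s)).
  apply: cvgD.
    by apply: cvgM cg; exact: derivable_cvg.
  by apply: cvgMr; exact: derivable_cvg.
apply/funext => s.
have e (k x y x' y' : C) : k * (x * y - x' * y') =
    k * (x - x') * y + x' * (k * (y - y')) by ring.
exact: e.
Qed.

Lemma smooth_lin n (c : C) f g : smooth n f -> smooth n g -> smooth n (c *: f + g).
Proof.
elim: n f g => [|n IH] f g /=.
  move=> cf cg t; have FF := nbhs_filter t.
  have ct : f s @[s --> t] --> (f t : C) by exact: cf.
  have dt : g s @[s --> t] --> (g t : C) by exact: cg.
  exact: (cvgD (cvgZr (k := c) ct) dt).
move=> [df sf] [dg sg]; have [? ->] := deriv_lin c df dg.
by split=> //; exact: IH.
Qed.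

Lemma smooth0 n : smooth n (0 : I -> C).
Proof.
have d0 : derivable_seg (0 : I -> C) /\ deriv_seg (0 : I -> C) = 0.
  apply: derivP => t; rewrite (_ : diff_quot 0 t = cst 0); first exact: cvg_cst.
  by apply/funext => s; rewrite /diff_quot subrr mulr0.
elim: n => [|n IH] /=; first exact: cst_continuous.
by split; [exact: d0.1|rewrite d0.2].
Qed.

Lemma smoothD n f g : smooth n f -> smooth n g -> smooth n (f + g).
Proof. by move=> sf sg; rewrite -[f]scale1r; exact: smooth_lin. Qed.

Lemma smoothM n f g : smooth n f -> smooth n g -> smooth n (f \* g).
Proof.
elim: n f g => [|n IH] f g sf sg; first last.
  have [sf' sg'] := (smoothW sf, smoothW sg).
  case: sf sg => [df sf] [dg sg] /=; have [? ->] := deriv_mul df dg.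
  by split=> //; apply: smoothD; exact: IH.
move=> t; have FF := nbhs_filter t.
have ct : f s @[s --> t] --> (f t : C) by exact: sf.
have dt : g s @[s --> t] --> (g t : C) by exact: sg.
exact: (cvgM ct dt).
Qed.

Lemma iter_deriv_lin n (c : C) f g j : smooth n f -> smooth n g -> (j <= n)%N ->
  iter j (@deriv_seg R a b) (c *: f + g) =
  c *: iter j (@deriv_seg R a b) f + iter j (@deriv_seg R a b) g.
Proof.
elim: n f g j => [|n IH] f g [|j]// [df sf] [dg sg] jn.
by rewrite !iterSr; have [_ ->] := deriv_lin c df dg; exact: IH.
Qed.

Lemma sup_norm_has_ub f : continuous f ->
  has_ubound (range (fun t => Normc.normc (f t))).
Proof.
move=> cf.
have cn : continuous (fun t => Normc.normc (f t) : R).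
  move=> t; apply/(@cvgrPdist_lt _ _ _ _ (nbhs_filter t)) => e e0.
  have /cvgrPdist_lt/(_ e%:C%C) := cf t; rewrite ltcR => /(_ e0).
  apply: filterS => s; rewrite normC_normc ltcR; apply: le_lt_trans.
  have := ler_dist_dist (f t) (f s); rewrite !normC_normc -raddfB.
  by rewrite /= expr0n addr0 sqrtr_sqr lecR.
have /subspace_valL_continuousP/continuous_compact := cn.
move=> /(_ (@segment_compact _ _ _))/compact_bounded [M [_ /(_ (M + 1))]].
rewrite ltrDl ltr01 => /(_ isT) hM; exists (M + 1) => _ [t _ <-].
apply: le_trans (ler_norm _) _; apply: hM => /=.
exists (set_val t); first exact: (set_valP t).
exact: (congr1 (@^~ t) (valLK _ (fun t => Normc.normc (f t) : R))).
Qed.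

Lemma sup_norm_ge f t : continuous f -> Normc.normc (f t) <= sup_norm f.
Proof. by move=> /sup_norm_has_ub/ub_le_sup; apply; exists t. Qed.

Lemma segment_inhab : inhabited I.
Proof.
have aA : a \in [set` `[a, b]] by rewrite inE /= in_itv /= lexx ltW.
by split; exists a.
Qed.

Lemma sup_norm_le f (r : R) : (forall t, Normc.normc (f t) <= r) -> sup_norm f <= r.
Proof.
move=> fr; have [t0] := segment_inhab.
apply: ge_sup; first by exists (Normc.normc (f t0)), t0.
by move=> _ [t _ <-].
Qed.

Lemma sup_normD f g : continuous f -> continuous g ->
  sup_norm (f + g) <= sup_norm f + sup_norm g.
Proof.
move=> cf cg; apply: sup_norm_le => t.
apply: le_trans (le_normcD _ _) _.
by apply: lerD; exact: sup_norm_ge.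
Qed.

Lemma sup_normZ_le (c : C) f : continuous f ->
  sup_norm (c *: f) <= Normc.normc c * sup_norm f.
Proof.
move=> cf; apply: sup_norm_le => t.
rewrite [X in X <= _](Normc.normcM c (f t)) ler_wpM2l ?sup_norm_ge//.
exact: normc_ge0.
Qed.

Lemma sup_normZ (c : C) f : continuous f ->
  sup_norm (c *: f) = Normc.normc c * sup_norm f.
Proof.
move=> cf; have ccf : continuous (c *: f).
  by have := @smooth_lin 0 c f 0 cf (smooth0 0); rewrite addr0.
apply/le_anti/andP; split; first exact: sup_normZ_le cf.
have [->|c0] := eqVneq c 0.
  rewrite Normc.normc0 mul0r; have [t] := segment_inhab.
  apply: le_trans (sup_norm_ge t _); first exact: normc_ge0.
  rewrite scale0r; exact: (smooth0 0).
have nc : 0 < Normc.normc c 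
  by rewrite lt_def normc_ge0 andbT; apply: contraNneq c0 => /Normc.eq0_normc ->.
rewrite -ler_pdivlMl//.
have := sup_normZ_le c^-1 ccf.
by rewrite scalerA mulVf// scale1r Normc.normcV.
Qed.

Lemma sup_norm_eq0 f : continuous f -> sup_norm f <= 0 -> f = 0.
Proof.
move=> cf f0; apply/funext => t; apply: Normc.eq0_normc.
apply/le_anti; rewrite (le_trans (sup_norm_ge t cf) f0) /=.
exact: normc_ge0.
Qed.

Lemma sup_norm_ge0 f : continuous f -> 0 <= sup_norm f.
Proof.
move=> cf; have [t] := segment_inhab; apply: le_trans (sup_norm_ge t cf).
exact: normc_ge0.
Qed.



End CalculusTheory.

Section Spaces.
Variables (R : realType) (a b : R) (ab : a < b).
Local Notation C := (Cx R).

Definition smooth_pred (_ : a < b) (n : nat) : pred (segment a b -> C) :=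
  fun f => `[< smooth n f >].

Lemma smooth_predP n f : reflect (smooth n f) (f \in smooth_pred ab n).
Proof. exact: asboolP. Qed.

Lemma smooth_pred_submod n : submod_closed (smooth_pred ab n).
Proof.
split=> [|c f g /smooth_predP sf /smooth_predP sg].
  exact/smooth_predP/smooth0.
exact/smooth_predP/smooth_lin.
Qed.
HB.instance Definition _ n := GRing.isSubmodClosed.Build C (segment a b -> C)
  (smooth_pred ab n) (smooth_pred_submod n).

(* The space C^(n). For [a = b] derivatives would not be unique and the
   expression for the norm below would not define a norm, hence the dependency
   on [ab]. *)
Definition Cn (n : nat) : Type := {f : segment a b -> C | smooth_pred ab n f}.
HB.instance Definition _ n := SubChoice.on (Cn n).
HB.instance Definition _ n := [SubChoice_isSubLmodule of Cn n by <:].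

Lemma Cn_smooth n (x : Cn n) : smooth n (val x).
Proof. exact/smooth_predP/(valP x). Qed.

Definition mkCn n f (sf : smooth n f) : Cn n := exist _ f (asboolT sf).

Definition Cn_norm n (x : Cn n) : C :=
  (\sum_(j < n.+1) sup_norm (iter j (@deriv_seg R a b) (val x)))%:C%C.

Lemma Cn_continuous n (x : Cn n) (j : 'I_n.+1) :
  continuous (iter j (@deriv_seg R a b) (val x)).
Proof. by apply: smooth_continuous (Cn_smooth x) _; rewrite -ltnS. Qed.

Lemma Cn_iter_lin n (c : C) (x y : Cn n) (j : 'I_n.+1) :
  iter j (@deriv_seg R a b) (val (c *: x + y)) =
  c *: iter j (@deriv_seg R a b) (val x) + iter j (@deriv_seg R a b) (val y).
Proof.
have jn : (j <= n)%N by rewrite -ltnS.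
exact: (iter_deriv_lin ab c (Cn_smooth x) (Cn_smooth y) jn).
Qed.

Lemma Cn_normD n (x y : Cn n) : Cn_norm (x + y) <= Cn_norm x + Cn_norm y.
Proof.
rewrite -raddfD lecR -big_split /=; apply: ler_sum => j _.
have := Cn_iter_lin 1 x y j; rewrite !scale1r => ->.
exact: (sup_normD ab (@Cn_continuous n x j) (@Cn_continuous n y j)).
Qed.

Lemma Cn_normZ n (c : C) (x : Cn n) : Cn_norm (c *: x) = `|c| * Cn_norm x.
Proof.
rewrite normC_normc -rmorphM mulr_sumr; congr (_%:C)%C; apply: eq_bigr => j _.
rewrite -(sup_normZ ab c (@Cn_continuous n x j)); congr sup_norm.
have := Cn_iter_lin (-1) (0 : Cn n) 0 j; rewrite scaler0 addr0 scaleN1r addNr.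
by have := Cn_iter_lin c x 0 j; rewrite addr0 => -> ->; rewrite addr0.
Qed.

Lemma Cn_norm_eq0 n (x : Cn n) : Cn_norm x = 0 -> x = 0.
Proof.
move=> /(@complexI R); rewrite big_ord_recl /= => s0.
apply/val_inj/(sup_norm_eq0 (@Cn_continuous n x ord0)).
rewrite -s0 lerDl; apply: sumr_ge0 => j _.
exact: (sup_norm_ge0 ab (@Cn_continuous n x (lift ord0 j))).
Qed.

HB.instance Definition _ n := Lmodule_isNormed.Build C (Cn n)
  (@Cn_normD n) (@Cn_normZ n) (@Cn_norm_eq0 n).

End Spaces.

(* m-dimensional vectors over a normed space, normed by the sum of the norms
   of the components. *)
Definition vec (V : Type) (m : nat) : Type := {ffun 'I_m -> V}.

Section Vectors.
Variables (K : numFieldType) (V : normedModType K) (m : nat).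
HB.instance Definition _ := GRing.Lmodule.copy (vec V m) {ffun 'I_m -> V}.

Definition vec_norm (v : vec V m) : K := \sum_i `|v i|.

Lemma vec_normD u v : vec_norm (u + v) <= vec_norm u + vec_norm v.
Proof.
rewrite -big_split /=; apply: ler_sum => i _.
by rewrite ffunE ler_normD.
Qed.

Lemma vec_normZ c v : vec_norm (c *: v) = `|c| * vec_norm v.
Proof. by rewrite mulr_sumr; apply: eq_bigr => i _; rewrite ffunE normrZ. Qed.

Lemma vec_norm_eq0 v : vec_norm v = 0 -> v = 0.
Proof.
move=> /psumr_eq0P v0; apply/ffunP => i; rewrite ffunE.
by apply/normr0_eq0/v0.
Qed.

HB.instance Definition _ := Lmodule_isNormed.Build K (vec V m)
  vec_normD vec_normZ vec_norm_eq0.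

End Vectors.

Section Operator.
Variables (R : realType) (a b : R) (ab : a < b) (n m : nat).
Local Notation Cn := (Cn ab).

Definition Cn_deriv (x : Cn n.+1) : Cn n := mkCn ab (Cn_smooth x).2.

Definition Cn_incl (x : Cn n.+1) : Cn n := mkCn ab (smoothW (Cn_smooth x)).

Definition Cn_mul (x y : Cn n) : Cn n :=
  mkCn ab (smoothM ab (Cn_smooth x) (Cn_smooth y)).

(* Componentwise form of [y' + A y]; see [Lop_val] for its pointwise values. *)
Definition Lop (A : 'M[Cn n]_m) (y : vec (Cn n.+1) m) : vec (Cn n) m :=
  [ffun i => Cn_deriv (y i) + \sum_j Cn_mul (A i j) (Cn_incl (y j))].

Lemma Lop_val A y i t : val (Lop A y i) t =
  deriv_seg (val (y i)) t + \sum_j val (A i j) t * val (y j) t.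
Proof.
rewrite ffunE; apply: (congr1 (+%R (deriv_seg (val (y i)) t))).
exact: (big_morph (fun x : Cn n => val x t) (fun _ _ => erefl) erefl).
Qed.

Lemma Lop_linear A : linear (Lop A).
Proof.
move=> c y z; apply/ffunP => i; apply/val_inj/funext => t.
have -> : val ((c *: Lop A y + Lop A z) i) t =
    c * val (Lop A y i) t + val (Lop A z i) t by rewrite !ffunE.
rewrite !Lop_val.
have e j : val ((c *: y + z) j) = c *: val (y j) + val (z j).
  by rewrite !ffunE linearP.
rewrite e (deriv_lin ab c (Cn_smooth (y i)).1 (Cn_smooth (z i)).1).2.
rewrite (eq_bigr (fun j => c * (val (A i j) t * val (y j) t)
  + val (A i j) t * val (z j) t)); last first.
  move=> j _; rewrite e.
  have e' (p q r : Cx R) : p * (c * q + r) = c * (p * q) + p * r by ring.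
  exact: e'.
rewrite big_split -mulr_sumr /=.
have e' (p q r s : Cx R) : c * p + q + (c * r + s) = c * (p + r) + (q + s) by ring.
exact: e'.
Qed.
HB.instance Definition _ A := GRing.isLinear.Build (Cx R) _ _ *:%R (Lop A) (Lop_linear A).

Variable l : nat.

(* The library norms [C^l] by the maximum of the moduli of the entries and a
   product by the maximum of the two norms; all choices are equivalent. *)
Definition LBop (A : 'M[Cn n]_m)
    (B : {linear vec (Cn n.+1) m -> 'cV[Cx R]_l}) (y : vec (Cn n.+1) m) :
    (vec (Cn n) m * 'cV[Cx R]_l)%type := (Lop A y, B y).

Lemma LBop_linear A B : linear (LBop A B).
Proof. by move=> c y z; rewrite /LBop !linearP. Qed.
HB.instance Definition _ A B :=
  GRing.isLinear.Build (Cx R) _ _ *:%R (LBop A B) (LBop_linear A B).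

End Operator.

Section Fredholm.
Variable K : numFieldType.

Section Dimension.
Variable V : lmodType K.

Definition is_basis (k : nat) (e : 'I_k -> V) :=
  (forall c : 'I_k -> K, \sum_i c i *: e i = 0 -> forall i, c i = 0) /\
  (forall v, exists c : 'I_k -> K, v = \sum_i c i *: e i).

Definition finite_dim := exists (k : nat) (e : 'I_k -> V), is_basis e.

(* Only meaningful when [finite_dim] holds; [0] otherwise. *)
Definition dim : nat :=
  xget 0%N [set k : nat | exists e : 'I_k -> V, is_basis e].

End Dimension.

Section KerCoker.
Variables (X Y : lmodType K) (T : {linear X -> Y}).

Definition ker_pred : pred X := fun x => T x == 0.

Lemma ker_pred_submod : submod_closed ker_pred.
Proof.
split=> [|c x y]; rewrite !unfold_in /ker_pred ?linear0//.
by move=> /eqP x0 /eqP y0; rewrite linearP x0 y0 scaler0 addr0.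
Qed.
HB.instance Definition _ :=
  GRing.isSubmodClosed.Build K X ker_pred ker_pred_submod.

Definition ker : Type := {x : X | ker_pred x}.
HB.instance Definition _ := SubChoice.on ker.
HB.instance Definition _ := [SubChoice_isSubLmodule of ker by <:].

Definition coker_rel : rel Y := fun y z => `[< exists x, y - z = T x >].

Lemma coker_rel_refl : reflexive coker_rel.
Proof. by move=> y; apply/asboolP; exists 0; rewrite subrr linear0. Qed.

Lemma coker_rel_sym : symmetric coker_rel.
Proof.
move=> y z; apply/asboolP/asboolP => -[x e]; exists (- x);
  by rewrite (linearN T) -e opprB.
Qed.

Lemma coker_rel_trans : transitive coker_rel.
Proof.
move=> z y w /asboolP[x e] /asboolP[x' e']; apply/asboolP; exists (x + x').
by rewrite (linearD T) -e -e' addrA subrK.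
Qed.

Canonical coker_equiv :=
  EquivRel coker_rel coker_rel_refl coker_rel_sym coker_rel_trans.

Local Open Scope quotient_scope.

Definition coker : Type := {eq_quot coker_rel}.
HB.instance Definition _ := Choice.on coker.
HB.instance Definition _ := EqQuotient.on coker.

Definition coker_zero : coker := \pi_coker 0.
Definition coker_opp (u : coker) : coker := \pi_coker (- repr u).
Definition coker_add (u v : coker) : coker := \pi_coker (repr u + repr v).
Definition coker_scale (c : K) (u : coker) : coker := \pi_coker (c *: repr u).

Lemma coker_eqP (y z : Y) :
  (exists x, y - z = T x) <-> \pi_coker y = \pi_coker z.
Proof.
split=> [h|/eqP].
  by apply/eqP; rewrite eqmodE; apply/asboolP.
by rewrite eqmodE => /asboolP.
Qed.

Lemma coker_repr (y : Y) : exists x, repr (\pi_coker y) - y = T x.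
Proof. by apply/coker_eqP; rewrite reprK. Qed.

Lemma coker_piN (y : Y) : coker_opp (\pi_coker y) = \pi_coker (- y).
Proof.
apply/coker_eqP; have [x e] := coker_repr y; exists (- x).
by rewrite (linearN T) -e opprB opprK addrC.
Qed.

Lemma coker_piD (y z : Y) :
  coker_add (\pi_coker y) (\pi_coker z) = \pi_coker (y + z).
Proof.
apply/coker_eqP; have [x e] := coker_repr y; have [x' e'] := coker_repr z.
by exists (x + x'); rewrite (linearD T) -e -e' opprD addrACA.
Qed.

Lemma coker_piZ c (y : Y) :
  coker_scale c (\pi_coker y) = \pi_coker (c *: y).
Proof.
apply/coker_eqP; have [x e] := coker_repr y; exists (c *: x).
by rewrite (linearZZ T) -e scalerBr.
Qed.

Lemma coker_ind (P : coker -> Prop) :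
  (forall y, P (\pi_coker y)) -> forall u, P u.
Proof. by move=> h u; rewrite -[u]reprK. Qed.

Lemma coker_addA : associative coker_add.
Proof.
elim/coker_ind=> x; elim/coker_ind=> y; elim/coker_ind=> z.
by rewrite !coker_piD addrA.
Qed.

Lemma coker_addC : commutative coker_add.
Proof. by elim/coker_ind=> x; elim/coker_ind=> y; rewrite !coker_piD addrC. Qed.

Lemma coker_add0 : left_id coker_zero coker_add.
Proof. by elim/coker_ind=> x; rewrite coker_piD add0r. Qed.

Lemma coker_addN : left_inverse coker_zero coker_opp coker_add.
Proof. by elim/coker_ind=> x; rewrite coker_piN coker_piD addNr. Qed.

HB.instance Definition _ := GRing.isZmodule.Build coker
  coker_addA coker_addC coker_add0 coker_addN.

Lemma coker_scaleA c d u : coker_scale c (coker_scale d u) = coker_scale (c * d) u.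
Proof. by elim/coker_ind: u => x; rewrite !coker_piZ scalerA. Qed.

Lemma coker_scale1 : left_id 1 coker_scale.
Proof. by elim/coker_ind=> x; rewrite coker_piZ scale1r. Qed.

Lemma coker_scaleDr : right_distributive coker_scale +%R.
Proof.
move=> c; elim/coker_ind=> x; elim/coker_ind=> y.
rewrite [\pi_coker x + \pi_coker y]coker_piD !coker_piZ scalerDr.
by rewrite [RHS]coker_piD.
Qed.

Lemma coker_scaleDl u : {morph coker_scale^~ u : c d / c + d}.
Proof.
elim/coker_ind: u => x c d /=.
by rewrite !coker_piZ scalerDl [RHS]coker_piD.
Qed.

HB.instance Definition _ := GRing.Zmodule_isLmodule.Build K coker
  coker_scaleA coker_scale1 coker_scaleDr coker_scaleDl.

End KerCoker.

(* [continuous T] is part of the definition. Completeness of [X] and [Y] plays no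
   role in it and is not required. *)
Definition fredholm (X Y : normedModType K) (T : {linear X -> Y}) : Prop :=
  [/\ continuous T, finite_dim (ker T) & finite_dim (coker T)].

Definition fredholm_index (X Y : lmodType K) (T : {linear X -> Y}) : int :=
  (dim (ker T))%:Z - (dim (coker T))%:Z.

End Fredholm.

(* Main.v *)
(** The operator [y |-> (L y, y(a))] is a linear bijection: by Picard iteration,
    the initial value problem [y' + A y = f], [y(a) = y0] has exactly one
    solution, which inherits its smoothness from [A] and [f] through the equation.
    Hence [L] is onto with an [m]-dimensional kernel, and [(L, B)] has the kernel
    and the cokernel of the restriction of [B] to [ker L], which is a linear map
    between spaces of dimensions [m] and [l]; its index is [m - l] whatever its
    rank.

    Picard's iterates are controlled by the mean value inequality: if the k-th
    increment is at most [c (t - a)^k], then the next one is at most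
    [c M (t - a)^(k+1) / (k + 1)], so that the increments are summable.  This uses
    the integral only through the existence of primitives. *)

Require Import Defs.
From mathcomp Require Import all_boot all_order all_algebra.
From mathcomp Require Import all_classical all_reals.
From mathcomp Require Import topology normedtype.
From mathcomp Require Import derive sequences measure lebesgue_measure.
From mathcomp Require Import lebesgue_integral ftc.
From mathcomp Require Import complex ring lra.

Set Implicit Arguments.
Unset Strict Implicit.
Unset Printing Implicit Defensive.

Import Order.TTheory GRing.Theory Num.Theory.
Import numFieldNormedType.Exports.

Local Open Scope classical_set_scope.
Local Open Scope ring_scope.

(** * Calculus on a segment *)

Section ComplexModulus.
Context {R : realType}.
Implicit Type z w : Cx R.

Lemma Re_le_normc z : `|complex.Re z| <= Normc.normc z.
Proof.
case: z => x y /=; rewrite -sqrtr_sqr ler_sqrt ?lerDl ?sqr_ge0 //.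
by rewrite addr_ge0 ?sqr_ge0.
Qed.

Lemma Im_le_normc z : `|complex.Im z| <= Normc.normc z.
Proof.
case: z => x y /=; rewrite -sqrtr_sqr ler_sqrt ?lerDr ?sqr_ge0 //.
by rewrite addr_ge0 ?sqr_ge0.
Qed.

Lemma normc_le_ReIm z : Normc.normc z <= `|complex.Re z| + `|complex.Im z|.
Proof.
case: z => x y /=; rewrite -(@ler_pXn2r _ 2) ?nnegrE ?sqrtr_ge0 ?addr_ge0 //.
rewrite sqr_sqrtr ?addr_ge0 ?sqr_ge0 // sqrrD !real_normK ?num_real //.
by rewrite addrAC lerDl mulrn_wge0 // mulr_ge0.
Qed.

Lemma normcN z : Normc.normc (- z) = Normc.normc z.
Proof. by case: z => x y /=; rewrite !sqrrN. Qed.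

Lemma normc_sum (I : Type) (s : seq I) (F : I -> Cx R) :
  Normc.normc (\sum_(i <- s) F i) <= \sum_(i <- s) Normc.normc (F i).
Proof.
elim/big_ind2: _ => [|x y z w hx hy|//]; first by rewrite Normc.normc0.
by apply: le_trans (le_normcD _ _) _; exact: lerD.
Qed.

(** The norm of [Cx R] takes its values in [Cx R], so the radii in the library's criterion are
    complex. A positive complex number is real, hence real radii suffice. *)
Lemma cvg_normcP (T : Type) (F : set_system T) (FF : Filter F) (h : T -> Cx R)
    (l : Cx R) :
  h @ F --> l <->
  forall e : R, 0 < e -> \forall x \near F, Normc.normc (l - h x) < e.
Proof.
split=> [/cvgrPdist_lt hl e e0|hl].
  have /hl : 0 < e%:C%C :> Cx R by rewrite ltcR.
  by apply: filterS => x; rewrite normC_normc ltcR.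
apply/cvgrPdist_lt => e e0.
have [r r0 ->] : exists2 r : R, 0 < r & e = r%:C%C.
  have := e0; rewrite ltcE /= => /andP[/eqP im re].
  by exists (complex.Re e) => //; case: (e) im re => x y /= -> _.
by apply: filterS (hl r r0) => x; rewrite normC_normc ltcR.
Qed.

End ComplexModulus.

(** * Extension to the real line and the mean value inequality *)

Section SegmentCalculus.
Context {R : realType} {a b : R} (ab : a < b).
Local Notation I := (segment a b).
Local Notation C := (Cx R).
Implicit Types (f g : I -> C) (s t : I).

Lemma nbhs_segmentP (P : I -> Prop) t :
  (\forall s \near t, P s) <->
  exists2 d : R, 0 < d & forall s, `|set_val t - set_val s| < d -> P s.
Proof.
split=> [/nbhs_ballP[e /= e0 h]|[d d0 h]].
  by exists e => // s ts; apply: h.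
by apply/nbhs_ballP; exists d => // s; exact: h.
Qed.

Lemma segment_val t : a <= set_val t <= b.
Proof. by have := set_valP t; rewrite /= in_itv. Qed.

Lemma clamp_subproof (x : R) :
  Num.min (Num.max a x) b \in [set` `[a, b]].
Proof.
by rewrite inE /= in_itv /= le_min le_max lexx (ltW ab) /= ge_min lexx orbT.
Qed.

(** The nearest-point retraction of the line onto the segment. Composing with it extends a function
    on the segment to the whole line, where the calculus of real functions applies. *)
Definition clamp (x : R) : I :=
  exist (fun y => y \in [set` `[a, b]]) _ (clamp_subproof x).

Lemma set_val_clamp x : a <= x <= b -> set_val (clamp x) = x.
Proof.
move=> /andP[ax xb]; have mx : Num.max a x = x by apply/max_idPr.
have : Num.min (Num.max a x) b = x by rewrite mx; apply/min_idPl.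
exact.
Qed.

Lemma clamp_set_val t : clamp (set_val t) = t.
Proof. by apply/val_inj; exact: (set_val_clamp (segment_val t)). Qed.

Lemma clamp_lipschitz x y : `|set_val (clamp x) - set_val (clamp y)| <= `|x - y|.
Proof.
suff h u v : u <= v -> `|set_val (clamp u) - set_val (clamp v)| <= `|u - v|.
  have [xy|/ltW yx] := leP x y; first exact: h.
  by rewrite distrC (distrC x); exact: h.
move=> uv; rewrite distrC (distrC u) (ger0_norm (_ : 0 <= v - u)) ?subr_ge0 //.
have e x' : set_val (clamp x') = Num.min (Num.max a x') b by [].
rewrite !e; case: (lerP a u) => ?; case: (lerP a v) => ?; case: (lerP u b) => ?;
  case: (lerP v b) => ?; case: (lerP a b) => ?; rewrite ler_norml;
  apply/andP; split; lra.
Qed.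

Definition segment_left : I := clamp a.

Lemma set_val_left : set_val segment_left = a.
Proof. by rewrite set_val_clamp // lexx ltW. Qed.


Lemma diff_quot_cvgP f t (l : C) :
  diff_quot f t @ t^' --> l <->
  forall e : R, 0 < e -> exists2 d : R, 0 < d & forall s, s != t ->
    `|set_val t - set_val s| < d -> Normc.normc (l - diff_quot f t s) < e.
Proof.
split=> [/cvg_normcP h e e0|h].
  have := h e e0; rewrite /dnbhs near_withinE => /nbhs_segmentP[d d0 hd].
  by exists d => // s st /hd; apply.
apply/cvg_normcP => e /h[d d0 hd]; rewrite /dnbhs near_withinE.
by apply/nbhs_segmentP; exists d => // s ts st; exact: hd.
Qed.

Lemma continuous_segmentP f :
  continuous f <-> forall t (e : R), 0 < e -> exists2 d : R, 0 < d & forall s,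
    `|set_val t - set_val s| < d -> Normc.normc (f t - f s) < e.
Proof.
split=> [cf t e e0|h t].
  apply/nbhs_segmentP; apply: (iffLR (cvg_normcP (nbhs_filter t) _ _)) => //.
  exact: cf.
by apply/(cvg_normcP (nbhs_filter t)) => e e0; apply/nbhs_segmentP; exact: h.
Qed.

(* [p] stands for the real or the imaginary part, or the opposite of one of them. *)
Section RealPart.
Variable p : C -> R.
Hypothesis pB : forall z w : C, p (z - w) = p z - p w.
Hypothesis p_le : forall z, `|p z| <= Normc.normc z.
Hypothesis pZ : forall (x : R) (z : C), p ((x%:C%C : C) * z) = x * p z.

Lemma continuous_part f : continuous f -> continuous (p \o f \o clamp).
Proof.
move=> /continuous_segmentP cf x; apply/cvgrPdist_lt => e /(cf (clamp x))[d d0 hd].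
near=> y; rewrite /= -pB; apply: le_lt_trans (p_le _) _; apply: hd.
apply: le_lt_trans (clamp_lipschitz _ _) _.
by near: y; apply: cvgr_dist_lt.
Unshelve. all: by end_near. Qed.

(** Restricted to interior points: the extension by [clamp] is constant beyond [a] and [b], so at
    these two points a two-sided derivative need not exist. *)
Lemma is_derive_part f x : derivable_seg f -> x \in `]a, b[ ->
  is_derive x 1 (p \o f \o clamp) (p (deriv_seg f (clamp x))).
Proof.
move=> df xab.
have xab' : a <= x <= b by rewrite !ltW ?(itvP xab).
suff h : (fun h : R => h^-1 *: ((p \o f \o clamp) (h + x) - (p \o f \o clamp) x))
    @ 0^' --> p (deriv_seg f (clamp x)).
  have e : (fun h : R => h^-1 *: ((p \o f \o clamp \o shift x) (h *: 1) -
      (p \o f \o clamp) x)) =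
      (fun h : R => h^-1 *: ((p \o f \o clamp) (h + x) - (p \o f \o clamp) x)).
    by apply/funext => h' /=; rewrite [h' *: 1]mulr1.
  apply: DeriveDef; rewrite /derivable /derive e.
    by apply/cvg_ex; eexists; exact: h.
  exact: (cvg_lim (@norm_hausdorff _ _) h).
apply/cvgrPdist_lt => e e0.
have /diff_quot_cvgP/(_ e e0)[d d0 hd] := derivable_cvg (t := clamp x) df.
near=> h.
have h0 : h != 0 by near: h; exact: nbhs_dnbhs_neq.
have hxab : h + x \in `]a, b[.
  have : `|h| < Num.min (x - a) (b - x).
    by near: h; apply: dnbhs0_lt; rewrite lt_min !subr_gt0 !(itvP xab).
  rewrite lt_min !ltr_norml in_itv /= => /andP[/andP[? ?] /andP[? ?]].
  by apply/andP; split; lra.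
have hxab' : a <= h + x <= b by rewrite !ltW ?(itvP hxab).
have hh : Normc.normc (deriv_seg f (clamp x) - diff_quot f (clamp x) (clamp (h + x))) < e.
  apply: hd.
    apply/eqP => /(congr1 set_val); rewrite !set_val_clamp // => /eqP.
    by rewrite -subr_eq0 addrK (negPf h0).
  by rewrite !set_val_clamp // distrC addrK; near: h; exact: dnbhs0_lt.
apply: le_lt_trans hh; apply: le_trans _ (p_le _).
rewrite [in leRHS]pB /diff_quot !set_val_clamp // addrK -fmorphV.
by rewrite pZ pB.
Unshelve. all: by end_near. Qed.

(** The function [q] is the primitive of the bound that vanishes at [a]. The difference of [q] and
    [p \o f] has nonnegative derivative inside the segment and is continuous on it, so its value at
    [t] is at least its value at [a]. *)
Lemma part_mean_value_le f (k : nat) (c : R) t : derivable_seg f ->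
  (forall s, Normc.normc (deriv_seg f s) <= c * (set_val s - a) ^+ k) ->
  p (f t) - p (f segment_left) <= c * (set_val t - a) ^+ k.+1 / k.+1%:R.
Proof.
move=> df dfc.
pose q : R -> R := (c / k.+1%:R) *: ((id - cst a) ^+ k.+1).
have qE x : q x = c / k.+1%:R * (x - a) ^+ k.+1.
  by rewrite /q !fctE.
have dq x : is_derive (x : R) (1 : R) q (c * (x - a) ^+ k).
  apply: is_derive_eq; rewrite !fctE /= subr0 /GRing.scale /= mulr1 mulrA.
  by rewrite mulfVK // pnatr_eq0.
pose h : R -> R := q - (p \o f \o clamp).
have dh x : x \in `]a, b[ ->
    is_derive x 1 h (c * (x - a) ^+ k - p (deriv_seg f (clamp x))).
  by move=> xab; apply: is_deriveB; exact: is_derive_part.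
have h1 x : x \in `]a, b[ -> derivable h x 1 by move=> /dh [].
have h2 x : x \in `]a, b[ -> 0 <= derive1 h x.
  move=> xab; rewrite derive1E; have [_ ->] := dh _ xab.
  have xE : set_val (clamp x) = x by rewrite set_val_clamp // !ltW ?(itvP xab).
  rewrite -[X in (X - a)]xE subr_ge0; apply: le_trans (dfc _).
  by apply: le_trans (p_le _); exact: ler_norm.
have h3 : {within `[a, b], continuous h}.
  apply: continuous_subspaceT => x; apply: cvgB.
    by apply/differentiable_continuous/derivable1_diffP; case: (dq x).
  by apply: continuous_part; exact: derivable_continuous.
have /andP[ta tb] := segment_val t.
have : h a <= h (set_val t) := ger0_derive1_ndecr h1 h2 h3 (lexx a) ta tb.
rewrite /h !fctE /= !qE clamp_set_val subrr expr0n mulr0 sub0r => H'.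
by rewrite mulrAC; move: H'; rewrite lerBrDr addrC.
Qed.

End RealPart.

(* The factor 2 is the price of bounding the real and imaginary parts separately. *)
Lemma mean_value_ineq f (k : nat) (c : R) t : derivable_seg f ->
  (forall s, Normc.normc (deriv_seg f s) <= c * (set_val s - a) ^+ k) ->
  Normc.normc (f t - f segment_left) <=
    c * 2 * (set_val t - a) ^+ k.+1 / k.+1%:R.
Proof.
move=> df dfc.
have Npart (p : C -> R) : (forall z w : C, p (z - w) = p z - p w) ->
    (forall z, `|p z| <= Normc.normc z) ->
    (forall (x : R) (z : C), p ((x%:C%C : C) * z) = x * p z) ->
    `|p (f t - f segment_left)| <= c * (set_val t - a) ^+ k.+1 / k.+1%:R.
  move=> pB p_le pZ; rewrite pB ler_norml (part_mean_value_le pB) // andbT lerNl.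
  (* The lower bound on [p] is the upper bound on its opposite. *)
  have := @part_mean_value_le (fun z => - p z) _ _ _ f k c t df dfc.
  rewrite opprB opprK addrC; apply => [z w|z|x z].
  - by rewrite pB opprB opprK addrC.
  - by rewrite normrN.
  - by rewrite pZ mulrN.
apply: le_trans (normc_le_ReIm _) _.
have e (x y z : R) : x * 2 * y * z = x * y * z + x * y * z by ring.
rewrite e.
apply: lerD; apply: Npart => [|z|].
- by case=> x y [].
- exact: Re_le_normc.
- by move=> x [u v] /=; rewrite mul0r subr0.
- by case=> x y [].
- exact: Im_le_normc.
- by move=> x [u v] /=; rewrite mul0r addr0.
Qed.

End SegmentCalculus.

(** * Primitives of continuous complex functions *)

Section Primitives.
Context {R : realType} {a b : R} (ab : a < b).
Local Notation I := (segment a b).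
Local Notation C := (Cx R).
Implicit Types (f g : I -> C) (s t : I).

Lemma real_primitive_exists (g : R -> R) : continuous g ->
  exists G : R -> R, forall x, a <= x -> is_derive x (1 : R) G (g x).
Proof.
(* Integrating from [a - 1] makes [a] an interior point. *)
move=> cg.
exists (parameterized_integral (@lebesgue_measure R) (a - 1) ^~ g) => x ax.
have ax1 : a - 1 < x by lra.
have xx1 : x < x + 1 by rewrite ltrDl.
have ig : (@lebesgue_measure R).-integrable `[a - 1, x + 1] (EFin \o g).
  apply: continuous_compact_integrable; first exact: segment_compact.
  exact: continuous_subspaceT.
have [dG dGE] := continuous_FTC1_closed xx1 ig ax1 (cg x).
apply: DeriveDef; first exact: dG.
by rewrite -derive1E; exact: dGE.
Qed.

(** The real and imaginary parts, extended by [clamp], have primitives [G] and [H] with two-sided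
    derivatives at every point of the segment, end points included. Restricting the difference
    quotients to the segment gives the derivative in the sense of [deriv_seg]. *)
Lemma primitive_exists f (y : C) : continuous f ->
  exists F, [/\ derivable_seg F, deriv_seg F = f & F (segment_left ab) = y].
Proof.
move=> cf.
have [|G dG] := @real_primitive_exists (@complex.Re R \o f \o clamp ab).
  apply: continuous_part cf => [[x1 x2] [u v]|z] //; exact: Re_le_normc.
have [|H dH] := @real_primitive_exists (@complex.Im R \o f \o clamp ab).
  apply: continuous_part cf => [[x1 x2] [u v]|z] //; exact: Im_le_normc.
pose F t : C := y + ((G (set_val t) - G a) +i* (H (set_val t) - H a))%C.
suff h t : diff_quot F t @ t^' --> f t.
  have [dF dFE] := derivP ab h; exists F; split=> //.
  by rewrite /F /segment_left set_val_left !subrr addr0.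
apply/diff_quot_cvgP => e e0.
have quot (K : R -> R) (k : R) : is_derive (set_val t) (1 : R) K k ->
    exists2 d : R, 0 < d & forall s, s != t -> `|set_val t - set_val s| < d ->
    `|k - (set_val s - set_val t)^-1 * (K (set_val s) - K (set_val t))| < e / 2.
  case=> dK kE.
  have h0 : (fun h : R =>
      h^-1 *: ((K \o shift (set_val t)) (h *: (1 : R)) - K (set_val t))) @ 0^' --> k by rewrite -kE; exact: dK.
  have e2 : 0 < e / 2 by rewrite divr_gt0.
  have := iffLR (@cvgrPdist_lt _ _ _ _ (dnbhs_filter (0 : R)) _ _) h0 _ e2.
  rewrite /dnbhs near_withinE => /nbhs_ballP[d /= d0 hd]; exists d => // s st sd.
  have := hd (set_val s - set_val t).
  rewrite /= [_ *: (1 : R)]mulr1 subrK; apply.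
    by rewrite /ball /= sub0r normrN distrC.
  by rewrite subr_eq0; apply: contra_neq st; exact: val_inj.
have [at_ tb] := andP (segment_val t).
have [d1 d10 h1] := quot _ _ (dG _ at_).
have [d2 d20 h2] := quot _ _ (dH _ at_).
exists (Num.min d1 d2); first by rewrite lt_min d10.
move=> s st; rewrite lt_min => /andP[/(h1 _ st) {}h1 /(h2 _ st) {}h2].
apply: le_lt_trans (normc_le_ReIm _) _; rewrite (splitr e).
move: h1 h2; rewrite /= clamp_set_val /diff_quot -fmorphV /F.
have e'' (z w : C) : y + z - (y + w) = z - w by ring.
rewrite e''.
case: (f t) => u v /=; rewrite !mul0r subr0 addr0.
have e' (p q r : R) : p - r - (q - r) = p - q by ring.
by rewrite !e'; exact: ltrD.
Qed.

End Primitives.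

(** * Initial value problems for linear systems *)

Section RealSequences.
Context {R : realType}.

(** The series of increments converges absolutely, and its partial sums telescope to [x] up to a
    constant. The error estimate is the triangle inequality between the indices [k] and [n], with
    [n] then sent to infinity. *)
Lemma cvg_of_summable_increments (x e : R^nat) :
  (forall k, `|x k.+1 - x k| <= e k) -> cvgn (series e) ->
  cvgn x /\ forall k, `|limn x - x k| <= limn (series e) - series e k.
Proof.
move=> xe ce.
have [c sx] : exists c, forall n, series [sequence x k.+1 - x k]_k n = x n - c.
  by exists (x 0%N) => n; rewrite /series /= telescope_sumr.
have cx : cvgn x.
  have /cvg_ex[l hl] : cvgn (series [sequence x k.+1 - x k]_k).
    apply: normed_cvg; apply: series_le_cvg ce => k /=; first exact: normr_ge0.
      exact: le_trans (normr_ge0 _) (xe k).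
    exact: xe.
  apply/cvg_ex; exists (l + c).
  rewrite (_ : x = (fun n => series [sequence x k.+1 - x k]_k n + c)).
    exact: cvgD hl (cvg_cst _).
  by apply/funext => n; rewrite sx subrK.
split=> // k.
have h n : (k <= n)%N -> `|x n - x k| <= series e n - series e k.
  move=> /subnKC <-; elim: (n - k)%N => [|d IH].
    by rewrite addn0 !subrr normr0.
  rewrite addnS -[x _.+1 - x k](subrKA (x (k + d)%N)) (le_trans (ler_normD _ _)) //.
  rewrite (_ : series e _.+1 = series e (k + d)%N + e (k + d)%N).
    by rewrite addrAC addrC; exact: lerD.
  by rewrite /series /= big_nat_recr.
have c1 : `|x n - x k| @[n --> \oo] --> `|limn x - x k|.
  by apply: cvg_norm; apply: cvgB => //; exact: cvg_cst.
have c2 : series e n - series e k @[n --> \oo] --> limn (series e) - series e k.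
  by apply: cvgB => //; exact: cvg_cst.
apply: ler_cvg_to c1 c2 _; near=> n; apply: h; near: n; exact: nbhs_infty_ge.
Unshelve. all: by end_near. Qed.

End RealSequences.

Section UniformLimit.
Context {R : realType} {a b : R}.
Local Notation I := (segment a b).
Local Notation C := (Cx R).

(** The Weierstrass test, applied to real and imaginary parts, followed by the usual three-term
    argument for the continuity of a uniform limit. *)
Lemma uniform_limit_exists (v : nat -> I -> C) (e : R^nat) :
  (forall k, continuous (v k)) -> cvgn (series e) ->
  (forall k t, Normc.normc (v k.+1 t - v k t) <= e k) ->
  exists2 u : I -> C, continuous u & forall r : R, 0 < r ->
    exists k, forall n t, (k <= n)%N -> Normc.normc (u t - v n t) <= r.
Proof.
move=> cv ce ve.
pose u t : C := (limn (fun k => complex.Re (v k t)) +i*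
  limn (fun k => complex.Im (v k t)))%C.
(* One tail for the real part and one for the imaginary part; the bound does not depend on [t]. *)
have huv t k : Normc.normc (u t - v k t) <= (limn (series e) - series e k) *+ 2.
  apply: le_trans (normc_le_ReIm _) _; rewrite mulr2n.
  have [|_ h1] := @cvg_of_summable_increments R (fun k => complex.Re (v k t)) e _ ce.
    move=> n; apply: le_trans (ve n t); apply: le_trans (Re_le_normc _).
    by case: (v n.+1 t) (v n t) => ? ? [].
  have [|_ h2] := @cvg_of_summable_increments R (fun k => complex.Im (v k t)) e _ ce.
    move=> n; apply: le_trans (ve n t); apply: le_trans (Im_le_normc _).
    by case: (v n.+1 t) (v n t) => ? ? [].
  move: (h1 k) (h2 k); rewrite /u; case: (v k t) => p q /=; exact: lerD.
have hu (r : R) : 0 < r -> exists k, forall n t, (k <= n)%N ->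
    Normc.normc (u t - v n t) <= r.
  move=> r0; have r2 : 0 < r / 2 by rewrite divr_gt0.
  have /cvgrPdist_le/(_ _ r2)[k _ hk] := ce; exists k => n t kn.
  apply: le_trans (huv t n) _; rewrite (splitr r) mulr2n.
  have := le_trans (ler_norm _) (hk n kn).
  by move=> h; exact: lerD.
exists u => //.
apply/continuous_segmentP => t r r0.
have r3 : 0 < r / 3 by rewrite divr_gt0.
have [k hk] := hu _ r3.
have /continuous_segmentP/(_ t _ r3)[d d0 hd] := cv k.
exists d => // s /hd hs.
rewrite (_ : u t - u s = (u t - v k t) + ((v k t - v k s) - (u s - v k s))); last first.
  have e' (x y z w : C) : x - w = (x - y) + ((y - z) - (w - z)) by ring.
  exact: e'.
apply: le_lt_trans (le_normcD _ _) _.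
apply: le_lt_trans (lerD (lexx _) (le_normcD _ _)) _.
rewrite normcN.
rewrite (_ : r = r / 3 + (r / 3 + r / 3)); last by field.
apply: ler_ltD; first exact: hk.
by apply: ltr_leD => //; exact: hk.
Qed.

End UniformLimit.

(** * Picard iteration *)

Section LinearSystems.
Context {R : realType} {a b : R} (ab : a < b) {m : nat}.
Local Notation I := (segment a b).
Local Notation C := (Cx R).
Local Notation left := (segment_left ab).
Implicit Types (u v f : 'I_m -> I -> C) (A : 'I_m -> 'I_m -> I -> C).

Lemma smooth_sum n (J : Type) (s : seq J) (F : J -> I -> C) :
  (forall j, smooth n (F j)) -> smooth n (\sum_(j <- s) F j).
Proof.
move=> sF; elim/big_ind: _ => //; first exact: smooth0.
exact: smoothD.
Qed.

Lemma deriv_sub (g h : I -> C) : derivable_seg g -> derivable_seg h ->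
  derivable_seg (g - h) /\ deriv_seg (g - h) = deriv_seg g - deriv_seg h.
Proof.
move=> dg dh; have := deriv_lin ab (-1) dh dg.
by rewrite !scaleN1r ![- _ + _]addrC.
Qed.

Lemma smooth_sub n (g h : I -> C) : smooth n g -> smooth n h -> smooth n (g - h).
Proof.
by move=> sg sh; have := smooth_lin ab (-1) sh sg; rewrite scaleN1r addrC.
Qed.

Definition mulv A u i : I -> C := fun t => \sum_j A i j t * u j t.

Lemma smooth_mulv n A u i : (forall i j, smooth n (A i j)) ->
  (forall j, smooth n (u j)) -> smooth n (mulv A u i).
Proof.
move=> sA su; rewrite (_ : mulv A u i = \sum_j (A i j \* u j)).
  by apply: smooth_sum => j; exact: smoothM.
by apply/funext => t; rewrite fct_sumE.
Qed.

Lemma mulvB A u v i : mulv A (fun j => u j - v j) i = mulv A u i - mulv A v i.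
Proof.
apply/funext => t; rewrite /mulv !fctE -sumrB; apply: eq_bigr => j _.
exact: mulrBr.
Qed.

(** A crude bound for the operator [mulv A] in the maximum norm: each of the [m] terms of a row is
    estimated with the sum over all entries. Any finite constant serves, since the factorials of
    [iterate_bound] outgrow its powers. *)
Definition row_bound A : R := m%:R * \sum_i \sum_j sup_norm (A i j).

Section Iterates.
Variable A : 'I_m -> 'I_m -> I -> C.
Hypothesis cA : forall i j, continuous (A i j).

Lemma row_bound_ge0 : 0 <= row_bound A.
Proof.
rewrite mulr_ge0 //; apply: sumr_ge0 => i _; apply: sumr_ge0 => j _.
exact: sup_norm_ge0.
Qed.

Lemma mulv_bound u (r : R) i t : (forall j, Normc.normc (u j t) <= r) ->
  Normc.normc (mulv A u i t) <= row_bound A * r.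
Proof.
move=> ur; apply: le_trans (normc_sum _ _) _.
have -> : row_bound A * r = \sum_(j < m) (\sum_i \sum_j sup_norm (A i j)) * r.
  by rewrite sumr_const card_ord /row_bound -mulrA mulr_natl.
apply: ler_sum => j _.
rewrite Normc.normcM; apply: ler_pM (ur j); try exact: normc_ge0.
apply: le_trans (sup_norm_ge t (@cA i j)) _.
rewrite (bigD1 i) //= (bigD1 j) //= -addrA lerDl addr_ge0 //.
  by apply: sumr_ge0 => j' _; exact: sup_norm_ge0.
by apply: sumr_ge0 => i' _; apply: sumr_ge0 => j' _; exact: sup_norm_ge0.
Qed.

(** The factor 2 is that of [mean_value_ineq], picked up once per iteration. *)
Let M := row_bound A * 2.

(** Stated for an abstract sequence because it serves twice: with the increments of Picard's
    iterates for existence, and with a constant sequence for uniqueness. Each induction step is one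
    use of [mean_value_ineq], whose denominator [k.+1] builds up the factorial. *)
Lemma iterate_bound (D : nat -> 'I_m -> I -> C) (G : R) :
  (forall j t, Normc.normc (D 0%N j t) <= G) ->
  (forall k i, derivable_seg (D k.+1 i)) ->
  (forall k i, deriv_seg (D k.+1 i) = - mulv A (D k) i) ->
  (forall k i, D k.+1 i left = 0) ->
  forall k i t, Normc.normc (D k i t) <= G * (M ^+ k * (set_val t - a) ^+ k / k`!%:R).
Proof.
move=> D0 dD DE Da; elim=> [|k IH] i t; first by rewrite !expr0 fact0 mulr1 divr1 mulr1.
pose c := row_bound A * (G * (M ^+ k / k`!%:R)).
have := @mean_value_ineq R a b ab (D k.+1 i) k c t (dD k i).
rewrite Da subr0; have -> : c * 2 * (set_val t - a) ^+ k.+1 / k.+1%:R =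
    G * (M ^+ k.+1 * (set_val t - a) ^+ k.+1 / (k.+1)`!%:R).
  rewrite /c factS natrM invfM (exprS M) {2}/M.
  have e (x y z w p q : R) : x * (y * (z * w)) * 2 * p * q =
      y * (x * 2 * z * p * (q * w)).
    by ring.
  exact: e.
apply=> s; rewrite DE [X in Normc.normc X]/= normcN -mulrA.
apply: mulv_bound => j; apply: le_trans (IH j s) _.
by rewrite -mulrA -!mulrA [_^-1 * _]mulrC.
Qed.

(** Replacing [set_val t - a] by [b - a] makes the bound uniform in [t]: it becomes a term of an
    exponential series, hence summable and tending to 0. *)
Lemma iterate_bound_exp (D : nat -> 'I_m -> I -> C) (G : R) :
  (forall j t, Normc.normc (D 0%N j t) <= G) ->
  (forall k i, derivable_seg (D k.+1 i)) ->
  (forall k i, deriv_seg (D k.+1 i) = - mulv A (D k) i) ->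
  (forall k i, D k.+1 i left = 0) ->
  forall k i t, Normc.normc (D k i t) <= G * exp_coeff (M * (b - a)) k.
Proof.
move=> D0 dD DE Da k i t; apply: le_trans (iterate_bound D0 dD DE Da k i t) _.
have G0 : 0 <= G by apply: le_trans (D0 i t); exact: normc_ge0.
have M0 : 0 <= M by rewrite mulr_ge0 // row_bound_ge0.
have /andP[ta tb] := segment_val t.
rewrite ler_wpM2l // /exp_coeff /= ler_wpM2r ?invr_ge0 // [(M * _) ^+ _]exprMn.
rewrite ler_wpM2l ?exprn_ge0 // lerXn2r ?nnegrE ?subr_ge0 ?(ltW ab) //.
exact: lerB.
Qed.

Lemma sup_bound_exists u : (forall j, continuous (u j)) ->
  exists G : R, forall j t, Normc.normc (u j t) <= G.
Proof.
move=> cu; exists (\sum_j sup_norm (u j)) => j t.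
apply: le_trans (sup_norm_ge t (cu j)) _.
by rewrite (bigD1 j) //= lerDl; apply: sumr_ge0 => j' _; exact: sup_norm_ge0.
Qed.

(** A solution of the homogeneous problem is a fixed point of the iteration, so the constant
    sequence at [u] satisfies [iterate_bound_exp]: [u] is bounded by every term of a sequence
    tending to 0. *)
Lemma linear_system_unique u : (forall i, derivable_seg (u i)) ->
  (forall i, deriv_seg (u i) = - mulv A u i) -> (forall i, u i left = 0) ->
  forall i, u i = 0.
Proof.
move=> du uE ua i; apply/funext => t; apply: Normc.eq0_normc.
have [G hG] := sup_bound_exists (fun j => derivable_continuous (du j)).
have h k : Normc.normc (u i t) <= G * exp_coeff (M * (b - a)) k.
  exact: (@iterate_bound_exp (fun=> u) G).
apply/le_anti; rewrite normc_ge0 andbT.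
have : G * exp_coeff (M * (b - a)) k @[k --> \oo] --> G * 0.
  by apply: cvgMl_tmp; exact: cvg_exp_coeff.
rewrite mulr0 => c0; apply: ler_cvg_to (cvg_cst _) c0 _.
exact: nearW.
Qed.

Lemma linear_system_exists f (y0 : 'I_m -> C) : (forall i, continuous (f i)) ->
  exists u, forall i, [/\ derivable_seg (u i), deriv_seg (u i) = f i - mulv A u i
    & u i left = y0 i].
Proof.
move=> cf.
(* The continuity premise stands inside the existential so that [choice] yields a map [Phi] on all
   families; for a discontinuous [u] the condition is vacuous. *)
have step u : exists v, (forall i, continuous (u i)) ->
    forall i, [/\ derivable_seg (v i), deriv_seg (v i) = f i - mulv A u i
    & v i left = y0 i].
  have [cu|ncu] := pselect (forall i, continuous (u i)); last by exists u.
  have h i : exists w, [/\ derivable_seg w, deriv_seg w = f i - mulv A u i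
      & w left = y0 i].
    apply: primitive_exists; apply: (smooth_sub (n := 0)); first exact: cf.
    exact: (smooth_mulv (n := 0)).
  by have [w hw] := choice h; exists w => _.
have [Phi hPhi] := choice step.
pose U k := iter k Phi (fun _ => cst 0).
have cU k i : continuous (U k i).
  elim: k i => [|k IH] i; first exact: cst_continuous.
  by have [dU _ _] := hPhi (U k) IH i; exact: derivable_continuous.
have hU k i : [/\ derivable_seg (U k.+1 i), deriv_seg (U k.+1 i) = f i - mulv A (U k) i
    & U k.+1 i left = y0 i] := hPhi (U k) (cU k) i.
(* The starting point 0 ignores [y0], so the first increment is only known to be bounded. From [U 1]
   on all iterates agree at [a], and the later increments vanish there, as [iterate_bound_exp]
   requires. *)
have cD i : continuous (U 1%N i - U 0%N i) by apply: (smooth_sub (n := 0)); exact: cU.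
have [G hG] := sup_bound_exists cD.
have hD := @iterate_bound_exp (fun k i => U k.+1 i - U k i) G hG.
have {}hD k i t : Normc.normc (U k.+1 i t - U k i t) <= G * exp_coeff (M * (b - a)) k.
  apply: hD => {}k {}i.
  - by have [d1 _ _] := hU k.+1 i; have [d2 _ _] := hU k i; have [] := deriv_sub d1 d2.
  - have [d1 e1 _] := hU k.+1 i; have [d2 e2 _] := hU k i.
    have [_ ->] := deriv_sub d1 d2; rewrite e1 e2 mulvB.
    by rewrite !opprB addrC addrA subrK.
  - by have [_ _ h1] := hU k.+1 i; have [_ _ h2] := hU k i;
    rewrite [LHS](_ : _ = U k.+2 i left - U k.+1 i left) // h1 h2 subrr.
have ce : cvgn (series (fun k => G * exp_coeff (M * (b - a)) k)).
  apply: (is_cvg_seriesZ (k := G) (f := exp_coeff (M * (b - a)))).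
  exact: is_cvg_series_exp_coeff.
have lim i := uniform_limit_exists (cU^~ i) ce (hD^~ i).
have [u cu hu] := all_sig2 (fun i => cid2 (lim i)).
(* The uniform limit [u] is only known to be continuous, so its derivative is not computed directly.
   One more Picard step gives a differentiable [w]; it is close to [U K.+1] because [u] is close to
   [U K], and this forces [w = u]. *)
have [w hw] : exists w, forall i, [/\ derivable_seg (w i),
  deriv_seg (w i) = f i - mulv A u i & w i left = y0 i] by exists (Phi u); exact: hPhi.
exists u; suff wu : w = u by move: hw; rewrite wu.
apply/funext => i; apply/funext => t; apply/eqP; rewrite -subr_eq0; apply/eqP.
have Mb : 0 <= M * (b - a).
  by rewrite mulr_ge0 ?subr_ge0 ?(ltW ab) // mulr_ge0 ?row_bound_ge0.
have M1 : 0 < M * (b - a) + 1 by exact: ltr_wpDl.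
apply: Normc.eq0_normc; apply/le_anti; rewrite normc_ge0 andbT.
apply/ler_addgt0Pr => e e0; rewrite add0r.
(* Chosen so that the two errors add up to [e]: at most [M * (b - a) * r] between [w] and [U K.+1],
   by the mean value inequality with exponent 0, and at most [r] between [u] and [U K.+1]. *)
pose r := e / (M * (b - a) + 1).
have r0 : 0 < r by rewrite divr_gt0.
have [K hK] : exists K, forall j t n, (K <= n)%N -> Normc.normc (u j t - U n j t) <= r.
  have [k hk] := choice (fun j => hu j r r0).
  exists (\max_j k j) => j s n kn; apply: hk; apply: leq_trans kn.
  exact: leq_bigmax.
have -> : e = M * (b - a) * r + r.
  by rewrite -[X in _ + X]mul1r -mulrDl /r mulrC divfK // gt_eqF.
rewrite (_ : w i t - u i t = (w i - U K.+1 i) t - (u i t - U K.+1 i t)); last first.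
  by rewrite [(w i - _) t]/= opprB subrKA.
apply: le_trans (le_normcD _ _) _; rewrite normcN; apply: lerD; last exact: hK.
have [dw we wa] := hw i; have [dU Ue Ua] := hU K i.
have [dwU wUe] := deriv_sub dw dU.
have := @mean_value_ineq R a b ab (w i - U K.+1 i) 0 (row_bound A * r) t dwU.
have -> : (w i - U K.+1 i) left = w i left - U K.+1 i left by [].
rewrite wa Ua subrr subr0 divr1 expr1.
move=> h; apply: le_trans (h _) _ => [s|].
  rewrite expr0 mulr1 wUe we Ue.
  have -> : f i - mulv A u i - (f i - mulv A (U K) i) =
      - mulv A (fun j => u j - U K j) i.
    by rewrite mulvB !opprB addrC addrA subrK.
  by rewrite normcN; apply: mulv_bound => j; exact: hK.
have /andP[ta tb] := segment_val t.
rewrite [row_bound A * r * 2]mulrAC -/M.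
rewrite mulrAC; apply: ler_wpM2r; first exact: ltW.
apply: ler_wpM2l; last exact: lerB.
by rewrite mulr_ge0 // row_bound_ge0.
Qed.

End Iterates.
End LinearSystems.

(** * The index of an operator extended by finitely many functionals *)

Section Dimension.
Context {K : numFieldType}.

(** The matrices [P] and [Q] expressing each family in the other have the identity of size [k] as
    their product, by freeness of [e]; an identity that factors through size [k'] forces the
    inequality. *)
Lemma is_basis_size_le (V : lmodType K) (k k' : nat) (e : 'I_k -> V) (e' : 'I_k' -> V) :
  is_basis e -> is_basis e' -> (k <= k')%N.
Proof.
move=> [e_free e_span] [e'_free e'_span].
have [P hP] := choice (fun i => e'_span (e i)).
have [Q hQ] := choice (fun j => e_span (e' j)).
apply: (@mulmx1_min _ _ _ (\matrix_(i, j) P i j) (\matrix_(j, i) Q j i)).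
apply/matrixP => i i'; rewrite !mxE.
under eq_bigr do rewrite !mxE.
apply/eqP; rewrite -subr_eq0; apply/eqP.
apply: (e_free (fun i' => \sum_j P i j * Q j i' - (i == i')%:R)).
under eq_bigr do rewrite scalerBl scaler_suml.
rewrite sumrB exchange_big /= [X in _ - X](bigD1 i) //= eqxx scale1r.
rewrite [X in _ - (_ + X)]big1 => [|p pi]; last by rewrite eq_sym (negPf pi) scale0r.
rewrite addr0; apply/eqP; rewrite subr_eq0 eq_sym; apply/eqP.
rewrite {1}(hP i); apply: eq_bigr => j _; rewrite {1}(hQ j) scaler_sumr.
by apply: eq_bigr => p _; rewrite scalerA.
Qed.

Lemma dim_is_basis (V : lmodType K) (k : nat) (e : 'I_k -> V) :
  is_basis e -> Defs.dim V = k.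
Proof.
move=> be; rewrite /Defs.dim; case: xgetP => [k' _ [e' be']|/(_ k) h].
  by apply/anti_leq; rewrite (is_basis_size_le be be') (is_basis_size_le be' be).
by case: h; exists e.
Qed.

Lemma coker_pi_sum (X Y : lmodType K) (T : {linear X -> Y}) (k : nat)
    (c : 'I_k -> K) (y : 'I_k -> Y) :
  \sum_i c i *: (\pi_(coker T) (y i))%qT = (\pi_(coker T) (\sum_i c i *: y i))%qT.
Proof.
symmetry; apply: (big_ind2 (fun u (v : coker T) => (\pi_(coker T) u)%qT = v)) => //.
  by move=> u _ v _ <- <-; rewrite -coker_piD.
by move=> i _; rewrite -coker_piZ.
Qed.

Lemma sum_pair (Y Z : zmodType) (J : Type) (s : seq J) (F : J -> (Y * Z)%type) :
  \sum_(j <- s) F j = (\sum_(j <- s) (F j).1, \sum_(j <- s) (F j).2).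
Proof.
by elim: s => [|j s IH]; rewrite !(big_nil, big_cons) // IH; case: (F j).
Qed.

End Dimension.

(** * Kernel and cokernel of a pair whose first component is onto *)

Section PairIndex.
Context {K : numFieldType} {X Y : lmodType K} {m l : nat}.
Variables (T : {linear X -> (Y * 'cV[K]_l)%type}) (phi : 'I_m -> X).
Hypothesis phi_ker : forall j, (T (phi j)).1 = 0.
Hypothesis phi_free : forall c : 'I_m -> K, \sum_j c j *: phi j = 0 -> forall j, c j = 0.
Hypothesis phi_span : forall x, (T x).1 = 0 ->
  exists c : 'I_m -> K, x = \sum_j c j *: phi j.
Hypothesis T1_onto : forall y, exists x, (T x).1 = y.

Let comb (c : 'rV[K]_m) : X := \sum_j c 0 j *: phi j.

(** The matrix of the second component of [T] on the kernel of the first, in the basis [phi]. It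
    acts on row vectors from the right, whence the transposes below. *)
Let Bm : 'M[K]_(m, l) := \matrix_(j, q) (T (phi j)).2 q 0.

Let T_comb c : T (comb c) = (0, (c *m Bm)^T).
Proof.
rewrite /comb linear_sum sum_pair; congr pair.
  by rewrite big1 // => j _; rewrite linearZ /= phi_ker scaler0.
apply/colP => q; rewrite !mxE summxE; apply: eq_bigr => j _.
by rewrite linearZ !mxE.
Qed.

Let comb_inj c : comb c = 0 -> c = 0.
Proof. by move=> /phi_free h; apply/rowP => j; rewrite h mxE. Qed.

Let combP x : (T x).1 = 0 -> exists c, x = comb c.
Proof.
move=> /phi_span[c ->]; exists (\row_j c j).
by apply: eq_bigr => j _; rewrite mxE.
Qed.

Let comb_mul k (c : 'rV[K]_k) (N : 'M[K]_(k, m)) :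
  comb (c *m N) = \sum_i c 0 i *: comb (row i N).
Proof.
rewrite /comb; under [RHS]eq_bigr do rewrite scaler_sumr.
rewrite exchange_big; apply: eq_bigr => j _; rewrite mxE scaler_suml.
by apply: eq_bigr => i _; rewrite mxE scalerA.
Qed.

(** An element of the kernel of [T] is some [comb c], and it is annihilated by [T] exactly when [c]
    lies in the left kernel of [Bm]; a row basis of that kernel is carried over by [comb]. *)
Lemma pair_ker_basis : exists e : 'I_(\rank (kermx Bm)) -> ker T, is_basis e.
Proof.
pose N := row_base (kermx Bm).
have NB : N *m Bm = 0 by apply/sub_kermxP; rewrite eq_row_base.
have eP i : ker_pred T (comb (row i N)).
  by rewrite /ker_pred T_comb -row_mul NB row0 trmx0.
pose e i : ker T := exist _ (comb (row i N)) (eP i).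
have val_e (c : 'rV_(\rank (kermx Bm))) : val (\sum_i c 0 i *: e i) = comb (c *m N).
  by rewrite comb_mul linear_sum; apply: eq_bigr => i _; rewrite linearZ.
exists e; split=> [c c0 i|[x xP]].
  have := val_e (\row_i c i); under eq_bigr do rewrite mxE.
  rewrite c0 => /esym/comb_inj/eqP.
  by rewrite mulmx_free_eq0 ?row_base_free // => /eqP/rowP/(_ i); rewrite !mxE.
have Tx : T x = 0 by exact/eqP.
have [|d xE] := @combP x; first by rewrite Tx.
have : (d <= N)%MS.
  rewrite eq_row_base; apply/sub_kermxP.
  by move: Tx; rewrite xE T_comb => -[] /(congr1 trmx); rewrite trmxK trmx0.
move=> /submxP[c dE]; exists (c 0); apply/val_inj.
by rewrite val_e -dE.
Qed.

(** Since the first component is onto, every class has a representative with first component 0, and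
    its second component matters only modulo the row space of [Bm]. A basis of a complement of that
    space therefore gives a basis of the cokernel. *)
Lemma pair_coker_basis : exists e : 'I_(\rank (Bm^C)%MS) -> coker T, is_basis e.
Proof.
pose W := row_base (Bm^C)%MS.
pose w i : (Y * 'cV[K]_l)%type := (0, (row i W)^T).
have w_sum (c : 'rV_(\rank (Bm^C)%MS)) : \sum_i c 0 i *: w i = (0, (c *m W)^T).
  rewrite sum_pair; congr pair; first by rewrite big1 // => j _; rewrite /= scaler0.
  by apply/colP => q; rewrite !mxE summxE; apply: eq_bigr => j _; rewrite !mxE.
exists (fun i => (\pi_(coker T) (w i))%qT); split=> [c c0 i|].
  have := w_sum (\row_i c i); under eq_bigr do rewrite mxE.
  (* A vanishing combination of classes is a value [T x] with first component 0, so that [x] is some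
     [comb d]; the combination of rows then lies both in the row space of [Bm] and in its
     complement. *)
  move: c0; rewrite coker_pi_sum => /(@coker_eqP _ _ _ T _ 0)[x]; rewrite subr0 => -> Tx.
  have [|d xE] := @combP x; first by rewrite Tx.
  move: Tx; rewrite xE T_comb => -[] /(congr1 trmx); rewrite !trmxK => dW.
  have : (\row_i c i *m W <= (Bm :&: Bm^C))%MS.
    rewrite sub_capmx -{1}dW submxMl /=.
    by rewrite -(eq_row_base (Bm^C)%MS) submxMl.
  rewrite capmx_compl submx0 mulmx_free_eq0 ?row_base_free //.
  by move=> /eqP/rowP/(_ i); rewrite !mxE.
elim/coker_ind => -[y v].
have [x Tx] := T1_onto y.
(* Subtracting [T x] removes [y]. The part of the remainder in the row space of [Bm] is the image of
   [comb d], and the part in the complement gives the coordinates. *)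
have : ((v - (T x).2)^T <= Bm + Bm^C)%MS by apply: submx_full; exact: addsmx_compl_full.
move=> /sub_addsmxP[[d c'] /= vE].
have /submxP[c cE] : (c' *m (Bm^C)%MS <= W)%MS by rewrite eq_row_base submxMl.
exists (c 0); rewrite coker_pi_sum w_sum; apply/coker_eqP.
exists (x + comb d); rewrite linearD T_comb -cE.
have -> : T x = (y, (T x).2) by rewrite -Tx; case: (T x).
move/(congr1 trmx): vE; rewrite trmxK linearD /= => vE.
rewrite -[LHS]/(y - 0, v - _) -[RHS]/(y + 0, _ + _) subr0 addr0; congr pair.
by apply/eqP; rewrite subr_eq -addrA -vE addrC subrK.
Qed.

(** The dimensions are [m] and [l], each diminished by the rank of [Bm], which cancels in the
    difference. *)
Lemma pair_finite_dim_index : [/\ finite_dim (ker T), finite_dim (coker T) &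
  fredholm_index T = m%:Z - l%:Z].
Proof.
have [e be] := pair_ker_basis; have [e' be'] := pair_coker_basis.
split; [by eexists; exists e | by eexists; exists e' |].
rewrite /fredholm_index (dim_is_basis be) (dim_is_basis be') mxrank_ker mxrank_compl.
rewrite -!subzn ?rank_leq_row ?rank_leq_col //; ring.
Qed.

End PairIndex.

(** * The differential operator and the boundary conditions *)

Section MultiplicationBound.
Context {R : realType} {a b : R} (ab : a < b).
Local Notation I := (segment a b).
Local Notation C := (Cx R).
Implicit Types (f g : I -> C).

(** The real number behind [Cn_norm], defined on bare functions so that inductions on [n] can pass
    to the derivative. *)
Definition smooth_norm n f : R := \sum_(j < n.+1) sup_norm (iter j (@deriv_seg R a b) f).

Lemma smooth_normS n f : smooth_norm n.+1 f = sup_norm f + smooth_norm n (deriv_seg f).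
Proof.
by rewrite /smooth_norm big_ord_recl; congr +%R; apply: eq_bigr => j _; rewrite -iterSr.
Qed.

Lemma smooth_norm_ge0 n f : smooth n f -> 0 <= smooth_norm n f.
Proof.
move=> sf; apply: sumr_ge0 => j _; apply: sup_norm_ge0 ab _ _.
by apply: (smooth_continuous sf); rewrite -ltnS.
Qed.

Lemma smooth_normW n f : smooth n.+1 f -> smooth_norm n f <= smooth_norm n.+1 f.
Proof.
move=> sf; rewrite /smooth_norm [leRHS]big_ord_recr lerDl /=.
by apply: (sup_norm_ge0 ab); exact: (@smooth_continuous R a b n.+1 f n.+1 sf).
Qed.

Lemma smooth_normD n f g : smooth n f -> smooth n g ->
  smooth_norm n (f + g) <= smooth_norm n f + smooth_norm n g.
Proof.
move=> sf sg; have := Cn_normD (mkCn ab sf) (mkCn ab sg).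
by rewrite -raddfD lecR.
Qed.

Lemma sup_normM f g : continuous f -> continuous g ->
  sup_norm (f \* g) <= sup_norm f * sup_norm g.
Proof.
move=> cf cg; apply: sup_norm_le => // t; rewrite Normc.normcM.
by apply: ler_pM; rewrite ?normc_ge0 //; exact: sup_norm_ge.
Qed.

(** By the product rule the norm of order [n.+1] splits into the supremum norm of the product and
    the norm of order [n] of two products, with factors [deriv_seg f] and [f]; the induction
    hypothesis applies to both. *)
Lemma smooth_norm_mul n f : smooth n f -> exists2 k : R, 0 <= k &
  forall g, smooth n g -> smooth_norm n (f \* g) <= k * smooth_norm n g.
Proof.
elim: n f => [|n IH] f sf.
  exists (sup_norm f); first exact: sup_norm_ge0.
  by move=> g sg; rewrite /smooth_norm !big_ord1; exact: (sup_normM sf sg).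
have [k1 k10 h1] := IH _ (smoothW sf).
case: (sf) => df sf'; have [k2 k20 h2] := IH _ sf'.
have cf := derivable_continuous df.
have f0 := sup_norm_ge0 ab cf.
exists (sup_norm f + (k2 + k1)); first by rewrite !addr_ge0.
move=> g sg; case: (sg) => dg sg'; have cg := derivable_continuous dg.
rewrite smooth_normS; have [_ ->] := deriv_mul ab df dg.
rewrite mulrDl; apply: lerD.
  apply: le_trans (sup_normM cf cg) _; apply: ler_wpM2l => //.
  by rewrite smooth_normS lerDl smooth_norm_ge0.
have sgW := smoothW sg; have sfW := smoothW sf.
apply: le_trans (smooth_normD _ _) _; [exact: smoothM | exact: smoothM |].
rewrite mulrDl; apply: lerD.
  apply: le_trans (h2 _ sgW) _; apply: ler_wpM2l => //; exact: smooth_normW.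
apply: le_trans (h1 _ sg') _; apply: ler_wpM2l => //.
by rewrite smooth_normS lerDr; exact: sup_norm_ge0.
Qed.

End MultiplicationBound.

(** * Continuity of the differential operator and its solutions *)

Section Operator.
Context {R : realType} {a b : R} (ab : a < b) {n m : nat}.
Local Notation I := (segment a b).
Local Notation C := (Cx R).
Local Notation left := (segment_left ab).
Variable A : 'M[Cn ab n]_m.
Implicit Type y : vec (Cn ab n.+1) m.

Lemma norm_Cn k (x : Cn ab k) : `|x| = (smooth_norm k (val x))%:C%C.
Proof. by []. Qed.

Lemma Cn_deriv_norm (x : Cn ab n.+1) : `|Cn_deriv x| <= `|x|.
Proof.
rewrite !norm_Cn lecR smooth_normS lerDr; apply: (sup_norm_ge0 ab).
exact: (derivable_continuous (Cn_smooth x).1).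
Qed.

Lemma Cn_mul_incl_norm (x : Cn ab n) : exists k : R, 0 <= k /\
  forall z : Cn ab n.+1, `|Cn_mul x (Cn_incl z)| <= k%:C%C * `|z|.
Proof.
have [k k0 hk] := smooth_norm_mul ab (Cn_smooth x); exists k; split=> // z.
rewrite !norm_Cn -rmorphM lecR; apply: le_trans (hk _ _) _.
  exact: (Cn_smooth (Cn_incl z)).
by apply: ler_wpM2l => //; exact: (smooth_normW ab (Cn_smooth z)).
Qed.

Lemma Lop_continuous : continuous (Lop A).
Proof.
have [k hk] := choice (fun ij : 'I_m * 'I_m => Cn_mul_incl_norm (A ij.1 ij.2)).
apply: bounded_linear_continuous; apply/linear_boundedP.
(* The 1 accounts for the derivative, the sum for multiplication by the entries of [A]. *)
pose N : C := 1 + \sum_i \sum_j (k (i, j))%:C%C.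
have k0 i j : 0 <= (k (i, j))%:C%C :> C by rewrite lecR; exact: (hk (i, j)).1.
exists N; split=> [|r Nr y].
  apply: ger0_real; rewrite addr_ge0 // sumr_ge0 // => i _; apply: sumr_ge0 => j _.
  exact: k0.
apply: (@le_trans _ _ (N * `|y|)); last by rewrite ler_wpM2r // ltW.
rewrite mulrDl mul1r mulr_suml -[`|Lop A y|]/(\sum_i `|Lop A y i|).
rewrite -{1}[`|y|]/(\sum_i `|y i|) -big_split /=; apply: ler_sum => i _.
rewrite ffunE; apply: le_trans (ler_normD _ _) _.
apply: lerD; first exact: Cn_deriv_norm.
apply: le_trans (ler_norm_sum _ _ _) _; rewrite mulr_suml; apply: ler_sum => j _.
apply: le_trans ((hk (i, j)).2 (y j)) _; apply: ler_wpM2l; first exact: k0.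
rewrite -[`|y|]/(\sum_i `|y i|) (bigD1 j) //= lerDl.
by apply: sumr_ge0.
Qed.

Lemma smooth_le k k' (f : I -> C) : (k <= k')%N -> smooth k' f -> smooth k f.
Proof.
move=> /subnKC <-; elim: (k' - k)%N => [|d IH]; first by rewrite addn0.
by rewrite addnS => /smoothW.
Qed.

(** Bootstrapping: if [u] is of class [k] with [k] at most [n], the equation makes its derivative of
    class [k], hence [u] is of class [k.+1]. *)
Lemma solution_smooth (M : 'I_m -> 'I_m -> I -> C) (f u : 'I_m -> I -> C) :
  (forall i j, smooth n (M i j)) -> (forall i, smooth n (f i)) ->
  (forall i, derivable_seg (u i)) -> (forall i, deriv_seg (u i) = f i - mulv M u i) ->
  forall i, smooth n.+1 (u i).
Proof.
move=> sM sf du uE; suff h k i : (k <= n.+1)%N -> smooth k (u i) by move=> i; exact: h.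
elim: k i => [|k IH] i kn; first exact: derivable_continuous.
split=> //; rewrite uE; apply: smooth_sub => //; first exact: smooth_le (sf i).
apply: smooth_mulv => [//|i' j|j]; first exact: smooth_le (sM i' j).
exact/IH/ltnW.
Qed.

Let M i j : I -> C := val (A i j).

Let LopE y i : val (Lop A y i) = deriv_seg (val (y i)) + mulv M (fun j => val (y j)) i.
Proof. by apply/funext => t; rewrite Lop_val. Qed.

Lemma Lop_solution_exists (f : vec (Cn ab n) m) (y0 : 'I_m -> C) :
  exists y, Lop A y = f /\ forall i, val (y i) left = y0 i.
Proof.
have sM i j : smooth n (M i j) by exact: Cn_smooth.
have sf i : smooth n (val (f i)) by exact: Cn_smooth.
have [||u hu] := @linear_system_exists R a b ab m M _ (fun i => val (f i)) y0.
- by move=> i j; exact: (@smooth_continuous R a b n _ 0%N (sM i j)).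
- by move=> i; exact: (@smooth_continuous R a b n _ 0%N (sf i)).
have su := solution_smooth sM sf (fun i => let: And3 h _ _ := hu i in h)
  (fun i => let: And3 _ h _ := hu i in h).
exists [ffun i => mkCn ab (su i)]; split=> [|i]; last by rewrite ffunE; case: (hu i).
apply/ffunP => i; apply/val_inj; rewrite LopE ffunE /=.
have [_ -> _] := hu i; rewrite (_ : (fun j => _) = u) ?subrK //.
by apply/funext => j; rewrite ffunE.
Qed.

Lemma Lop_solution_unique y : Lop A y = 0 -> (forall i, val (y i) left = 0) -> y = 0.
Proof.
move=> Ly y0; apply/ffunP => i; apply/val_inj; rewrite [in RHS]ffunE.
apply: (@linear_system_unique R a b ab m M _ (fun i => val (y i))) => // {}i.
- by move=> j; exact: (@smooth_continuous R a b n _ 0%N (Cn_smooth (A i j))).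
- by case: (Cn_smooth (y i)).
- apply/eqP; rewrite -addr_eq0; apply/eqP; rewrite -LopE Ly.
  by rewrite ffunE.
Qed.

Lemma val_comb (k : nat) (c : 'I_k -> C) (phi : 'I_k -> vec (Cn ab n.+1) m) i t :
  val ((\sum_j c j *: phi j) i) t = \sum_j c j * val (phi j i) t.
Proof.
apply: (big_rec2 (fun (u : vec (Cn ab n.+1) m) v => val (u i) t = v)).
  by rewrite ffunE.
by move=> j u v _ <-; rewrite !ffunE.
Qed.

(** The solution [phi j] starts at the [j]-th unit vector, so evaluation at [a] reads off the
    coefficients of a combination. This gives freeness, and any solution equals the combination with
    its own initial values as coefficients, by uniqueness. *)
Lemma fundamental_system_exists : exists phi : 'I_m -> vec (Cn ab n.+1) m,
  [/\ forall j, Lop A (phi j) = 0,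
    forall c : 'I_m -> C, \sum_j c j *: phi j = 0 -> forall j, c j = 0 &
    forall y, Lop A y = 0 -> exists c : 'I_m -> C, y = \sum_j c j *: phi j].
Proof.
have [phi hphi] := choice (fun j => Lop_solution_exists 0 (fun i => (i == j)%:R)).
have phi_left (c : 'I_m -> C) i : val ((\sum_j c j *: phi j) i) left = c i.
  rewrite val_comb (bigD1 i) //= (hphi i).2 eqxx mulr1 big1 ?addr0 // => j ji.
  by rewrite (hphi j).2 eq_sym (negPf ji) mulr0.
exists phi; split=> [j|c c0 j|y Ly]; first exact: (hphi j).1.
  by rewrite -phi_left c0 ffunE.
exists (fun i => val (y i) left); apply/eqP; rewrite -subr_eq0; apply/eqP.
apply: Lop_solution_unique.
  pose L : {linear vec (Cn ab n.+1) m -> vec (Cn ab n) m} := Lop A.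
  have Lphi j : L (phi j) = 0 := (hphi j).1.
  rewrite -[LHS]/(L _) linearB [L y]Ly sub0r linear_sum big1 ?oppr0 // => j _.
  by rewrite (linearZZ L) Lphi scaler0.
move=> i; rewrite !ffunE.
by rewrite -[LHS]/(val (y i) left - val ((\sum_j _ *: phi j) i) left) phi_left subrr.
Qed.

End Operator.

Theorem mainTheorem1 (R : realType) (a b : R) (ab : a < b) (m l n : nat)
    (m_gt0 : (0 < m)%N) (l_gt0 : (0 < l)%N)
    (A : 'M[Cn ab n]_m)
    (B : {linear vec (Cn ab n.+1) m -> 'cV[Cx R]_l}) (B_cont : continuous B) :
  fredholm (LBop A B) /\ fredholm_index (LBop A B) = m%:Z - l%:Z.
Proof.
have [phi [phi_ker phi_free phi_span]] := fundamental_system_exists A.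
(* Any initial value would do; 0 is taken. *)
have onto f : exists y, (LBop A B y).1 = f.
  have [y [yf _]] := Lop_solution_exists A f (fun=> 0).
  by exists y.
have [fker fcoker ind] :=
  pair_finite_dim_index (T := LBop A B) phi_ker phi_free phi_span onto.
split=> //; split=> // y.
have Ly : Lop A z @[z --> y] --> Lop A y := @Lop_continuous _ _ _ _ _ _ A y.
have By : B z @[z --> y] --> B y := B_cont y.
exact: (cvg_pair Ly By).
Qed.
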